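(* Let $(E,\|\cdot\|_E)$ be a normed $\mathbb{K}$-algebra, let $(G,\mathcal{T})$ be a Hausdorff topological vector space, and let $j:(E,\|\cdot\|_E)\to(G,\mathcal{T})$ be a continuous linear mapping. Assume that for every $T\in G$ there exists $(u_\varepsilon)_\varepsilon\in\mathcal{H}_A(E)$ such that $j(u_\varepsilon)\to T$ in $(G,\mathcal{T})$ as $\varepsilon\to 0$. Then there exists at least one embedding $i_G$ from $(G,\mathcal{T})$ into the N-generalized algebra $\mathcal{A}(\mathcal{C},E)$. Furthermore, if for all $v\in E$ there exists $(u_\varepsilon)_\varepsilon\in\mathcal{H}_A(E)$ such that $(u_\varepsilon-v)_\varepsilon\in\mathcal{I}_{I_A}(E)$, then $$\forall u\in E,\quad (i_G\circ j)(u)\overset{G,\mathcal{T}}{\simeq} i_0(u).$$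
   Context: $\mathbb{K}$ is $\mathbb{R}$ or $\mathbb{C}$. A subset $A\subset\mathbb{K}^{]0,1]}$ is solid if $(s_\varepsilon)_\varepsilon\in A$ and $|t_\varepsilon|\le|s_\varepsilon|$ for each $\varepsilon\in]0,1]$ imply $(t_\varepsilon)_\varepsilon\in A$. Fix a solid subring $A$ of $\mathbb{K}^{]0,1]}$ containing the constant family $(1)_\varepsilon$, and a solid ideal $I_A$ of $A$ such that $\lim_{\varepsilon\to0}r_\varepsilon=0$ for all $(r_\varepsilon)_\varepsilon\in I_A$. Set $\mathcal{C}=A/I_A$ (ring of generalized numbers), $A^+=\{(r_\varepsilon)_\varepsilon\in A: r_\varepsilon\in\mathbb{R}_+\ \forall\varepsilon\}$ and $I_A^+=\{(r_\varepsilon)_\varepsilon\in I_A: r_\varepsilon\in\mathbb{R}_+\ \forall\varepsilon\}$. For a normed algebra $E$ the N-generalized algebra is $\mathcal{A}(\mathcal{C},E)=\mathcal{H}_A(E)/\mathcal{I}_{I_A}(E)$, where $\mathcal{H}_A(E)=\{(u_\varepsilon)_\varepsilon\in E^{]0,1]}:(\|u_\varepsilon\|_E)_\varepsilon\in A^+\}$ and $\mathcal{I}_{I_A}(E)=\{(u_\varepsilon)_\varepsilon\in E^{]0,1]}:(\|u_\varepsilon\|_E)_\varepsilon\in I_A^+\}$; $cl(u_\varepsilon)_\varepsilon$ denotes the class of $(u_\varepsilon)_\varepsilon$. It is a vector space over $\mathbb{K}$. The trivial embedding $i_0:E\to\mathcal{A}(\mathcal{C},E)$ sends $u$ to the class of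 the constant family equal to $u$. An embedding of a vector space into $\mathcal{A}(\mathcal{C},E)$ means a linear one-to-one mapping. $U=cl(u_\varepsilon)_\varepsilon\in\mathcal{A}(\mathcal{C},E)$ and $T\in G$ are $(G,\mathcal{T})$-associated, written $U\overset{G,\mathcal{T}}{\sim}T$, if $j(u_\varepsilon)\to T$ in $(G,\mathcal{T})$ as $\varepsilon\to0$ (this does not depend on the representative). $U,V\in\mathcal{A}(\mathcal{C},E)$ are $(G,\mathcal{T})$-weakly equal, written $U\overset{G,\mathcal{T}}{\simeq}V$, if $(U-V)\overset{G,\mathcal{T}}{\sim}0$. *)

(* Defs.v *)
From HB Require Import structures.
From mathcomp Require Import all_boot all_order all_algebra.
From mathcomp Require Import all_classical all_reals all_analysis.
From mathcomp Require Import complex.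

Set Implicit Arguments.
Unset Strict Implicit.
Unset Printing Implicit Defensive.

Import Order.TTheory GRing.Theory Num.Theory.
Import numFieldNormedType.Exports.
Export numFieldNormedType.Exports.
Import Quotient.Exports.

Local Open Scope classical_set_scope.
Local Open Scope ring_scope.
Local Open Scope quotient_scope.

Variant scalar_kind := RealScalars | ComplexScalars.

Definition scalar_field (R : realType) (k : scalar_kind) : numFieldType :=
  match k with
  | RealScalars => R
  | ComplexScalars => R[i]
  end.

(* Nets are functions on the type of reals in ]0, 1]; the filter below is
   "eps -> 0" on that type. *)
Definition eps_index (R : realType) := {e : R | 0 < e <= 1}.

Definition eps_to0 (R : realType) : set_system (eps_index R) :=
  filter_from [set d : R | 0 < d] (fun d => [set e : eps_index R | val e < d]).

Arguments eps_to0 R : clear implicits.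

#[global] Instance eps_to0_filter (R : realType) : ProperFilter (eps_to0 R).
Proof.
apply: filter_from_proper; first apply: filter_from_filter.
- by exists 1 => /=.
- move=> a b /= a0 b0; exists (Num.min a b) => /=; first by rewrite lt_min a0.
  by move=> e /=; rewrite lt_min => /andP[].
- move=> d /= d0.
  have h : 0 < Num.min 1 (d / 2) <= 1.
    by rewrite lt_min ltr01 divr_gt0//= ge_min lexx.
  exists (exist _ (Num.min 1 (d / 2)) h) => /=.
  by rewrite gt_min ltr_pdivrMr// ltr_pMr// ltr1n orbT.
Qed.

(* Normed algebras are not assumed unital, hence not based on algType. *)
HB.mixin Record NormedModule_isNormedAlgebra (K : numFieldType) E
    & NormedModule K E := {
  nalg_mul : E -> E -> E ;
  nalg_mulA : associative nalg_mul ;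
  nalg_mull : forall y : E, linear (nalg_mul^~ y) ;
  nalg_mulr : forall x : E, linear (nalg_mul x) ;
  nalg_norm_mul : forall x y : E, `|nalg_mul x y| <= `|x| * `|y|
}.

#[short(type="normedAlgType")]
HB.structure Definition NormedAlgebra (K : numFieldType) :=
  {E of NormedModule K E & NormedModule_isNormedAlgebra K E}.

Lemma scalar_archi (R : realType) (k : scalar_kind) (x : scalar_field R k) :
  exists n : nat, `|x| <= n%:R.
Proof.
case: k x => /= x; first by exists (Num.truncn `|x|).+1; exact/ltW/truncnS_gt.
have -> : `|x| = (complex.Re `|x|)%:C%C by rewrite normc_def.
set r := complex.Re _; exists (Num.truncn r).+1.
by rewrite -(rmorph_nat (real_complex R)) lecR; exact/ltW/truncnS_gt.
Qed.

Section GeneralizedNumbers.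
Variables (R : realType) (k : scalar_kind).
Local Notation K := (scalar_field R k).
Local Notation I := (eps_index R).

Definition solid (A : set (I -> K)) :=
  forall s t : I -> K, A s -> (forall e, `|t e| <= `|s e|) -> A t.

(* The data (A, I_A) defining the ring of generalized numbers C = A / I_A. The
   ring operations on nets are the pointwise ones; [subring_closed] includes the
   constant net 1. *)
Record gen_numbers := GenNumbers {
  gnA : set (I -> K) ;
  gnI : set (I -> K) ;
  gnA_subring : subring_closed (mem gnA) ;
  gnA_solid : solid gnA ;
  gnI_sub : gnI `<=` gnA ;
  gnI_zmod : zmod_closed (mem gnI) ;
  gnI_ideal : forall a r : I -> K, gnA a -> gnI r -> gnI (a * r) ;
  gnI_solid : solid gnI ;
  gnI_cvg0 : forall r : I -> K, gnI r -> r e @[e --> eps_to0 R] --> (0 : K)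
}.

End GeneralizedNumbers.

Section NGeneralizedAlgebra.
Variables (R : realType) (k : scalar_kind) (C : gen_numbers R k).
Local Notation K := (scalar_field R k).
Local Notation I := (eps_index R).

(* Norms take their values in K itself; in R[i], [0 <= z] means that z is a
   nonnegative real. *)
Definition gnA_pos : set (I -> K) := [set r | gnA C r /\ forall e, 0 <= r e].
Definition gnI_pos : set (I -> K) := [set r | gnI C r /\ forall e, 0 <= r e].

Lemma gnA_sub (r s : I -> K) : gnA C r -> gnA C s -> gnA C (r - s).
Proof.
by have [_ h _] := gnA_subring C => /mem_set + /mem_set => /h/[apply]/set_mem.
Qed.

Lemma gnI_subr (r s : I -> K) : gnI C r -> gnI C s -> gnI C (r - s).
Proof.
by have [_ h] := gnI_zmod C => /mem_set + /mem_set => /h/[apply]/set_mem.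
Qed.

Lemma gnA1 : gnA C 1.
Proof. by have [h _ _] := gnA_subring C; exact: set_mem. Qed.

Lemma gnI0 : gnI C 0.
Proof. by have [h _] := gnI_zmod C; exact: set_mem. Qed.

Lemma gnA_add (r s : I -> K) : gnA C r -> gnA C s -> gnA C (r + s).
Proof.
move=> Ar As; rewrite -(opprK s); apply: gnA_sub => //.
by rewrite -[- s]sub0r; apply: gnA_sub => //; exact: (gnI_sub gnI0).
Qed.

Lemma gnI_add (r s : I -> K) : gnI C r -> gnI C s -> gnI C (r + s).
Proof.
move=> Ar As; rewrite -(opprK s); apply: gnI_subr => //.
by rewrite -[- s]sub0r; apply: gnI_subr => //; exact: gnI0.
Qed.

Lemma gnA_natl n (r : I -> K) : gnA C r -> gnA C (r *+ n).
Proof.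
move=> Ar; elim: n => [|n IH]; first exact: (gnI_sub gnI0).
by rewrite mulrS; exact: gnA_add.
Qed.

Lemma gnI_natl n (r : I -> K) : gnI C r -> gnI C (r *+ n).
Proof.
move=> Ar; elim: n => [|n IH]; first exact: gnI0.
by rewrite mulrS; exact: gnI_add.
Qed.

Section Moderate.
Variable E : normedModType K.

(* H_A(E) and I_{I_A}(E). *)
Definition moderate_set : set (I -> E) := [set u | gnA_pos (fun e => `|u e|)].
Definition negligible_set : set (I -> E) :=
  [set u | gnI_pos (fun e => `|u e|)].

Lemma norm_lin_le n (c : K) (u v : I -> E) : `|c| <= n%:R ->
  forall e, `| `|(c *: u + v) e| | <=
    `|((fun e => `|u e|) *+ n + (fun e => `|v e|) : I -> K) e|.
Proof.
have E0 e : ((fun e => `|u e|) *+ n + (fun e => `|v e|) : I -> K) e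
    = `|u e| *+ n + `|v e|.
  congr (_ + _); elim: n => // n IH; rewrite !mulrS -IH //.
move=> cn e; rewrite normr_id E0 ger0_norm ?addr_ge0 ?mulrn_wge0//.
apply: (le_trans (ler_normD _ _)); rewrite lerD2r.
have -> : ((c *: u) e) = c *: u e by [].
by rewrite normrZ -mulr_natl ler_wpM2r.
Qed.

Definition moderate_pred : {pred I -> E} := mem moderate_set.

Lemma moderate_submod : submod_closed moderate_pred.
Proof.
split=> [|c u v /set_mem[Au _] /set_mem[Av _]]; apply/mem_set; split => //.
  apply: (gnA_solid (gnI_sub gnI0)) => e /=.
  by rewrite normr_id normr0.
have [n cn] := scalar_archi c.
by apply: gnA_solid (norm_lin_le u v cn); apply: gnA_add => //; exact: gnA_natl.
Qed.

HB.instance Definition _ :=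
  GRing.isSubmodClosed.Build K (I -> E) moderate_pred moderate_submod.

Definition moderate := {u : I -> E | moderate_pred u}.

HB.instance Definition _ := SubChoice.on moderate.
HB.instance Definition _ := [SubChoice_isSubLmodule of moderate by <:].

Definition negligible_pred : {pred moderate} :=
  mem [set u : moderate | negligible_set (val u)].

Lemma negligible_submod : submod_closed negligible_pred.
Proof.
split=> [|c u v /set_mem[Au _] /set_mem[Av _]]; apply/mem_set; split => //.
  apply: (gnI_solid gnI0) => e /=.
  by rewrite normr_id normr0.
have [n cn] := scalar_archi c.
apply: gnI_solid (norm_lin_le (val u) (val v) cn).
by apply: gnI_add => //; exact: gnI_natl.
Qed.

HB.instance Definition _ :=
  GRing.isSubmodClosed.Build K moderate negligible_pred negligible_submod.

(* H_A(E) / I_{I_A}(E), with its K-vector space structure. *)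
Definition gen_alg := Quotient.quot negligible_pred.

HB.instance Definition _ := GRing.Zmodule.on gen_alg.

Definition cl (u : moderate) : gen_alg := \pi_(Quotient.quot negligible_pred) u.

Definition gen_scale (c : K) : gen_alg -> gen_alg :=
  fun U => cl (c *: (repr U : moderate)).

Lemma cl_eq (u v : moderate) : (cl u = cl v) <-> (u - v \in negligible_pred).
Proof.
by rewrite Quotient.idealrBE; split => [/eqP//|/eqP].
Qed.

Lemma reprE (U : gen_alg) : cl (repr U) = U.
Proof. exact: reprK. Qed.

Lemma cl_scale (c : K) (u : moderate) : gen_scale c (cl u) = cl (c *: u).
Proof.
apply/cl_eq; rewrite -scalerBr; apply: rpredZ.
by apply/cl_eq; rewrite reprE.
Qed.

Lemma cl_add (u v : moderate) : cl (u + v) = cl u + cl v.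
Proof. exact: (@raddfD _ _ (\pi_(Quotient.quot negligible_pred)) u v). Qed.

Lemma gen_scaleA a b U : gen_scale a (gen_scale b U) = gen_scale (a * b) U.
Proof. by rewrite -(reprE U) !cl_scale scalerA. Qed.

Lemma gen_scale1 : left_id 1 gen_scale.
Proof. by move=> U; rewrite -(reprE U) cl_scale scale1r. Qed.

Lemma gen_scaleDr : right_distributive gen_scale +%R.
Proof.
move=> c U V; rewrite -(reprE U) -(reprE V) -cl_add !cl_scale -cl_add.
by rewrite scalerDr.
Qed.

Lemma gen_scaleDl U : {morph gen_scale^~ U : a b / a + b}.
Proof. by move=> a b; rewrite -(reprE U) !cl_scale -cl_add scalerDl. Qed.

HB.instance Definition _ := GRing.Zmodule_isLmodule.Build K gen_alg
  gen_scaleA gen_scale1 gen_scaleDr gen_scaleDl.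

Lemma moderate_cst (x : E) : moderate_pred (fun=> x).
Proof.
apply/mem_set; split => //.
have [n xn] := scalar_archi (`|x| : K).
apply: (gnA_solid (gnA_natl n gnA1)) => e.
have -> : ((1 : I -> K) *+ n) e = n%:R.
  by elim: n {xn} => // n IH; rewrite !mulrS -IH.
by rewrite (ger0_norm (ler0n _ _)).
Qed.

(* The embedding i_0. *)
Definition triv_emb (x : E) : gen_alg := cl (exist _ (fun=> x) (moderate_cst x)).

Variables (G : topologicalLmodType K) (j : E -> G).

(* Quantifying over all representatives is harmless: by [associated_repr] one
   of them suffices when j is linear and continuous. *)
Definition associated (U : gen_alg) (T : G) :=
  forall u : moderate, cl u = U -> j (val u e) @[e --> eps_to0 R] --> T.

Lemma associated_repr (u : moderate) (T : G) : linear j -> continuous j ->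
  j (val u e) @[e --> eps_to0 R] --> T -> associated (cl u) T.
Proof.
move=> jlin jc juT v /cl_eq /set_mem [/= Ivu _].
have w0 : (val v e - val u e) @[e --> eps_to0 R] --> (0 : E).
  by apply/norm_cvg0P; exact: (gnI_cvg0 Ivu).
have jD x y : j (x + y) = j x + j y by have := jlin 1 x y; rewrite !scale1r.
have j0 : j 0 = 0 by apply: (addrI (j 0)); rewrite -jD !addr0.
have jw0 : j (val v e - val u e) @[e --> eps_to0 R] --> (0 : G).
  by rewrite -j0; exact: (cvg_comp _ _ w0 (jc 0)).
have -> : (fun e => j (val v e)) =
    (fun e => j (val v e - val u e) + j (val u e)).
  by apply/funext => e; rewrite -jD subrK.
rewrite -[T]add0r.
apply: (@cvg_comp _ _ _
  (fun e => (j (val v e - val u e), j (val u e))) (fun x : G * G => x.1 + x.2)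
  _ (nbhs ((0, T) : G * G))); first exact: cvg_pair.
exact: (@add_continuous G (0, T)).
Qed.

Definition weakly_equal (U V : gen_alg) := associated (U - V) 0.

End Moderate.
End NGeneralizedAlgebra.

(* Main.v *)
(* The pairs (U, T) with U associated to T form a linear subspace of
   A(C, E) x G which projects onto G, so Zorn's lemma extracts from it the graph
   of a linear map i_G.  Limits in G being unique, T is determined by i_G T;
   and both i_G (j u) and i_0 u are associated to j u. *)
From HB Require Import structures.
Require Import Defs.
From mathcomp Require Import all_boot all_order all_algebra.
From mathcomp Require Import all_classical all_reals all_analysis.

Set Implicit Arguments.
Unset Strict Implicit.
Unset Printing Implicit Defensive.

Import GRing.Theory Num.Theory.
Import numFieldNormedType.Exports.

Local Open Scope classical_set_scope.
Local Open Scope ring_scope.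

Definition lin_closed (K : fieldType) (V : lmodType K) (A : set V) :=
  forall (a : K) (x y : V), A x -> A y -> A (a *: x + y).

Section LinearSelection.
Variables (K : fieldType) (V W : lmodType K).
Implicit Types A B H : set (V * W).

(* The empty set qualifies: Zorn_bigcup needs the union of the empty chain. *)
Definition functional_subspace H A :=
  [/\ A `<=` H, lin_closed A & forall w, A (0, w) -> w = 0].

Lemma functional_subspace_max H : exists A, functional_subspace H A /\
  forall B, A `<` B -> ~ functional_subspace H B.
Proof.
apply: Zorn_bigcup => F FP Ftot; split.
- by move=> p [A /FP[AH _ _]]; exact: AH.
- move=> a p q [A FA Ap] [B FB Bq].
  have [AB|BA] := Ftot _ _ FA FB.
    by exists B => //; have [_ Blin _] := FP _ FB; apply: Blin => //; exact: AB.
  by exists A => //; have [_ Alin _] := FP _ FA; apply: Alin => //; exact: BA.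
- by move=> w [A /FP[_ _ A0]]; exact: A0.
Qed.

(** The one-dimensional step of the Zorn argument. A pair [a *: (v, w) + q] over 0 with [a] nonzero
    would make [v] a multiple of the first component of [q], hence a point where [A] already has a
    value; so [a] is 0 and the pair is [q] itself. *)
Lemma functional_subspace_extend H A v w :
  lin_closed H -> functional_subspace H A -> A 0 ->
  (forall w', ~ A (v, w')) -> H (v, w) ->
  functional_subspace H [set p | exists a q, A q /\ p = a *: (v, w) + q].
Proof.
move=> Hlin [AH Alin A0] A00 vA Hvw; split.
- by move=> _ [a [q [Aq ->]]]; apply: Hlin => //; exact: AH.
- move=> c _ _ [a [p [Ap ->]]] [b [q [Aq ->]]].
  exists (c * a + b), (c *: p + q); split; first exact: Alin.
  by rewrite scalerDr scalerA scalerDl addrACA.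
- move=> z [a [[x y] [Axy [xE ->]]]].
  have [a0|a0] := eqVneq a 0.
    move: xE Axy; rewrite a0 !scale0r !add0r => <-; exact: A0.
  (* Here [x = - (a *: v)], so scaling [(x, y)] by [- a^-1] gives an element of [A] over [v]. *)
  exfalso; apply: (vA (- a^-1 *: y)).
  have -> : (v, - a^-1 *: y) = - a^-1 *: (x, y) + 0.
    rewrite addr0; congr (_, _).
    have -> : x = - (a *: v) by apply/eqP; rewrite -addr_eq0 addrC -xE.
    by rewrite scalerN scaleNr opprK scalerA mulVf// scale1r.
  exact: Alin.
Qed.

(** A maximal functional subspace has full domain, since over a missing [v] any [w] with [H (v, w)]
    would enlarge it. It is then the graph of the map sought. *)
Lemma linear_selection H : lin_closed H -> (forall v, exists w, H (v, w)) ->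
  exists f : {linear V -> W}, forall v, H (v, f v).
Proof.
move=> Hlin Htot.
have [A [PA Amax]] := functional_subspace_max H.
have [AH Alin A0] := PA.
have H0 : H 0.
  have [w Hw] := Htot 0.
  by have := Hlin (-1) _ _ Hw Hw; rewrite scaleN1r addNr.
have A00 : A 0.
  (* Without 0, [A] would be empty and thus strictly below the zero subspace. *)
  apply: contrapT => nA; apply: (Amax [set 0]).
    split=> [p Ap | sub0A]; last by apply: nA; exact: sub0A.
    exfalso; apply: nA.
    by have := Alin (-1) _ _ Ap Ap; rewrite scaleN1r addNr.
  split; [by move=> _ -> | | by move=> w []].
  by move=> a _ _ -> ->; rewrite scaler0 addr0.
have Atot v : exists w, A (v, w).
  apply: contrapT => nAv.
  have vA w' : ~ A (v, w') by move=> h; apply: nAv; exists w'.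
  have [w Hvw] := Htot v.
  apply: (Amax _ _ (functional_subspace_extend Hlin PA A00 vA Hvw)).
  split=> [p Ap | subA].
    by exists 0, p; split => //; rewrite scale0r add0r.
  apply: (vA w); apply: subA.
  by exists 1, 0; split => //; rewrite scale1r addr0.
have [f Af] := choice Atot.
have flin : linear f.
  move=> a x y; apply/eqP; rewrite -subr_eq0; apply/eqP; apply: A0.
  (* Two elements of [A] lie over [a *: x + y]; their difference lies over 0, so its second
     component vanishes. *)
  rewrite -(subrr (a *: x + y)) (_ : (_, _) =
    -1 *: (a *: (x, f x) + (y, f y)) + (a *: x + y, f (a *: x + y))).
    exact: Alin (Alin _ _ _ (Af x) (Af y)) (Af _).
  by rewrite scaleN1r [RHS]addrC.
pose fL := GRing.isLinear.Build K V W *:%R f flin.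
pose g : {linear V -> W} := HB.pack f fL.
by exists g => v; exact: AH.
Qed.

End LinearSelection.

Section Association.
Variables (R : realType) (k : scalar_kind) (C : gen_numbers R k).
Local Notation K := (scalar_field R k).
Variables (E : normedModType K) (G : topologicalLmodType K).
Variables (j : {linear E -> G}) (jcont : continuous j).
Implicit Types (U V : gen_alg C E) (S T : G).

Lemma associated_linear (a : K) U V S T :
  associated j U S -> associated j V T -> associated j (a *: U + V) (a *: S + T).
Proof.
rewrite -(reprE U) -(reprE V) => /(_ _ erefl) US /(_ _ erefl) VT.
have -> : a *: cl (repr U) + cl (repr V) = cl (a *: repr U + repr V).
  by rewrite cl_add -cl_scale.
apply: associated_repr => //; first exact: linearP.
pose ju e := j (val (repr U : moderate C E) e).
pose jv e := j (val (repr V : moderate C E) e).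
have -> : (fun e => j (val (a *: repr U + repr V : moderate C E) e)) =
    (fun e => a *: ju e + jv e) by apply/funext => e; rewrite -linearP.
have aUS : a *: ju e @[e --> eps_to0 R] --> a *: S.
  (* The scalar becomes a constant net, so that the joint continuity of scaling in [G] applies. *)
  have acst : (fun=> a : K^o) @ eps_to0 R --> (a : K^o) by exact: cvg_cst.
  exact: cvg_comp2 acst US (@scale_continuous K G (a, S)).
exact: cvg_comp2 aUS VT (@add_continuous G (_, _)).
Qed.

(** The source of injectivity: [S] and [T] are limits of one net, the image under [j] of a
    representative of [U]. *)
Lemma associated_unique U S T : hausdorff_space G ->
  associated j U S -> associated j U T -> S = T.
Proof.
rewrite -(reprE U) => hG /(_ _ erefl) US /(_ _ erefl) UT.
exact: (cvg_unique _ US UT).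
Qed.

Lemma associated_triv_emb (x : E) : associated j (triv_emb C x) (j x).
Proof.
apply: associated_repr => //; first exact: linearP.
exact: (@cvg_cst _ (j x) _ (eps_to0 R) _).
Qed.

End Association.

Theorem proposition2 (R : realType) (k : scalar_kind) (C : gen_numbers R k)
    (E : normedAlgType (scalar_field R k))
    (G : topologicalLmodType (scalar_field R k)) (Ghausdorff : hausdorff_space G)
    (j : {linear E -> G}) (jcont : continuous j)
    (japprox : forall T : G, exists u : moderate C E,
      j (val u e) @[e --> eps_to0 R] --> T) :
  exists iG : {linear G -> gen_alg C E},
    injective iG /\
    ((forall v : E, exists u : moderate C E,
        negligible_set C (fun e => val u e - v)) ->
     forall u : E, weakly_equal j (iG (j u)) (triv_emb C u)).
Proof.
have [||iG iGP] := @linear_selection _ G (gen_alg C E)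
  (* The vector of [G] comes first, so that the selection maps [G] to classes. *)
  [set p | associated j p.2 p.1].
- by move=> a p q; exact: associated_linear.
- move=> T; have [u uT] := japprox T.
  by exists (cl u); apply: associated_repr => //; exact: linearP.
exists iG; split=> [S T ST | _ u].
  by apply: (associated_unique Ghausdorff (iGP S)); rewrite ST; exact: iGP.
(* Both the difference of classes and its limit 0, written as [- j u + j u], take the shape
   [-1 *: _ + _] of [associated_linear]. *)
rewrite /weakly_equal addrC -scaleN1r -(addNr (j u)) -[- j u]scaleN1r.
apply: associated_linear => //; last exact: iGP.
exact: associated_triv_emb.
Qed.
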